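(* Let $\alpha=(\alpha_1,\dots,\alpha_k)$ be a composition of $n$ with $k$ parts. Fix positive integers $i_1<i_2<\dots<i_k$ and consider the set of all words (rearrangements) of the multiset containing $i_j$ with multiplicity $\alpha_j$ for $j=1,\dots,k$ (i.e. words with this fixed content, whose packed content is $\alpha$). Then the number of Sylvester equivalence classes of these words is \[\det\left[\binom{\,j+\sum_{\ell=1}^{i}\alpha_{k+1-\ell}\,}{\,j-(i-1)\,}\right]_{1\le i,j\le k-1}\] (the empty determinant, for $k=1$, being $1$).
   Context: Words are finite sequences of positive integers. The packed content of a word is the composition listing the multiplicities of its distinct letters in increasing order of the letters. Two words $w_1,w_2$ are Sylvester adjacent if there are words $u,v,w$ and letters $a\le b<c$ with $w_1=u\,a\,c\,v\,b\,w$ and $w_2=u\,c\,a\,v\,b\,w$ (concatenation). Sylvester equivalence is the equivalence relation generated by Sylvester adjacency (words $u,v$ are equivalent if there is a chain $u=x_1,x_2,\dots,x_m=v$ with consecutive terms Sylvester adjacent). A binomial coefficient $\binom{N}{r}$ with $r<0$ is $0$. *)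

(* Defs.v *)
From HB Require Import structures.
From mathcomp Require Import all_boot all_order all_algebra.
From Stdlib Require Import Relations.
Set Implicit Arguments. Unset Strict Implicit. Unset Printing Implicit Defensive.
Import GRing.Theory Num.Theory.

Definition sylv_adj (w1 w2 : seq nat) : Prop :=
  exists (u v w : seq nat) (a b c : nat),
    [/\ a <= b, b < c,
        w1 = u ++ a :: c :: v ++ b :: w &
        w2 = u ++ c :: a :: v ++ b :: w].

Definition sylv_equiv : seq nat -> seq nat -> Prop :=
  clos_refl_sym_trans (seq nat) sylv_adj.

Definition num_classes (T : Type) (R : T -> T -> Prop) (P : T -> Prop)
    (N : nat) : Prop :=
  exists f : T -> 'I_N,
    (forall i : 'I_N, exists x, P x /\ f x = i) /\
    (forall x y, P x -> P y -> (R x y <-> f x = f y)).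

Definition base_word (letters alpha : seq nat) : seq nat :=
  flatten [seq nseq a.2 a.1 | a <- zip letters alpha].

(* The (k-1)x(k-1) matrix, 0-indexed (i,j) <-> 1-indexed (i+1,j+1):
   entry binom(j+1 + sum_{l=1}^{i+1} alpha_{k+1-l}, (j+1) - i),
   which is 0 when (j+1) - i < 0. *)
Definition sylv_matrix (k : nat) (alpha : seq nat) : 'M[int]_(k.-1) :=
  \matrix_(i < k.-1, j < k.-1)
    (if i <= j.+1 then
       Posz 'C(j.+1 + \sum_(l < i.+1) nth 0 alpha (k.-1 - l), j.+1 - i)
     else 0%R).

(* Main.v *)
Require Import Defs.
From HB Require Import structures.
From mathcomp Require Import all_boot all_order all_algebra.
From mathcomp Require Import zify.
From Stdlib Require Import Relations.
Import GRing.Theory Num.Theory.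
Set Implicit Arguments. Unset Strict Implicit.
Unset Printing Implicit Defensive.

(** A Sylvester class is determined by how many right-to-left weak minima the
    subword on the letters >= a has, for each letter a. Adding a smallest letter
    a with multiplicity m to a word y on larger letters, the copies of a can be
    gathered into one block, which moves left freely past every letter of y
    that is not such a minimum; so the class of the result depends only on the
    class of y and on the number t of minima of y to the right of the block,
    and the new number of minima is m + t, with t arbitrary between 0 and the
    number of minima of y.
    The possible sequences of numbers are counted by the Steck determinant of
    the C(S_i + 1, j - i + 1), with S_i the sum of the last i parts: the count
    and the determinant, as functions of the B_i = S_i + 1, both obey
    D(B_1, ..., B_m) = D(B_1 - 1, ..., B_m - 1) + D(B_2, ..., B_m). By Vandermonde's convolution, the matrix of the
    C(S_i + j, j - i + 1) differs from this one by a unitriangular factor. *)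

(** * Sylvester steps as swaps of adjacent letters *)

Lemma sylv_adj_cat2l p w w' : sylv_adj w w' -> sylv_adj (p ++ w) (p ++ w').
Proof.
move=> [u [v [t [a [b [c [ab bc -> ->]]]]]]].
by exists (p ++ u), v, t, a, b, c; rewrite -!catA.
Qed.

Lemma sylv_equiv_cat2l p w w' :
  sylv_equiv w w' -> sylv_equiv (p ++ w) (p ++ w').
Proof.
elim=> {w w'} [w w' adj|w|w w' _ IH|w1 w2 w3 _ IH1 _ IH2].
- by apply: rst_step; apply: sylv_adj_cat2l.
- exact: rst_refl.
- exact: rst_sym.
- exact: rst_trans IH1 IH2.
Qed.

Definition swappable (b x y : nat) := (x <= b < y) || (y <= b < x).

Lemma sylv_swap p x y z b :
  swappable b x y -> b \in z ->
  sylv_equiv (p ++ x :: y :: z) (p ++ y :: x :: z).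
Proof.
move=> sw /path.splitPr [v w].
by case/orP: sw => /andP[ab bc]; [|apply: rst_sym]; apply: rst_step;
  [exists p, v, w, x, b, y|exists p, v, w, y, b, x].
Qed.

Lemma sylv_stepP w w' : sylv_adj w w' \/ sylv_adj w' w ->
  exists p x y z b, [/\ swappable b x y, b \in z,
    w = p ++ x :: y :: z & w' = p ++ y :: x :: z].
Proof.
by case=> -[u [v [t [a [b [c [ab bc -> ->]]]]]]];
  [exists u, a, c, (v ++ b :: t), b|exists u, c, a, (v ++ b :: t), b];
  rewrite mem_cat mem_head orbT /swappable ab bc ?orbT.
Qed.

(** [swappable] is symmetric in the two letters, so one swap prepended to a chain covers both
    directions of an adjacency, and symmetry needs no case of its own. *)
Lemma sylv_ind (P : seq nat -> seq nat -> Prop) :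
  (forall w, P w w) ->
  (forall p x y z b w, swappable b x y -> b \in z ->
     P (p ++ y :: x :: z) w -> P (p ++ x :: y :: z) w) ->
  forall w w', sylv_equiv w w' -> P w w'.
Proof.
move=> P0 PS w w' eqw; have := clos_rst_rst1n _ _ _ _ eqw.
elim=> {w w' eqw} // w w' w'' step _.
by have [p [x [y [z [b [sw bz -> ->]]]]]] := sylv_stepP step; apply: PS sw bz.
Qed.

(** * Spines and codes as class invariants *)

(* The number of right-to-left weak minima of [w], i.e. the length of the left
   spine of the binary search tree built by inserting [w] from right to left. *)
Fixpoint spine (w : seq nat) : nat :=
  if w is x :: w' then all (leq x) w' + spine w' else 0.

Definition code (ls w : seq nat) : seq nat :=
  [seq spine [seq x <- w | a <= x] | a <- ls].

Lemma leq_spine_cat u z : spine z <= spine (u ++ z).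
Proof. by elim: u => //= x u IH; apply: leq_trans IH (leq_addl _ _). Qed.

(** The larger of the two letters exceeds [b], which stands to its right, so it is a minimum in
    neither order; the smaller one is unaffected by the larger. *)
Lemma spine_swap p x y z b : swappable b x y -> b \in z ->
  spine (p ++ x :: y :: z) = spine (p ++ y :: x :: z).
Proof.
move=> sw bz; elim: p => [|t p /= ->] /=; last first.
  by congr (_ + _); rewrite !all_cat /= (andbCA (t <= x)).
have high c : b < c -> all (leq c) z = false.
  by move=> bc; apply/negP => /allP/(_ _ bz); rewrite leqNgt bc.
case/orP: sw => /andP[ab bc]; rewrite (high _ bc) ?andbF !add0n ?addn0.
  by rewrite (ltnW (leq_ltn_trans ab bc)).
by rewrite (ltnW (leq_ltn_trans ab bc)).
Qed.

Lemma code_sylv ls w w' : sylv_equiv w w' -> code ls w = code ls w'.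
Proof.
move: w w'; apply: sylv_ind => // p x y z b w sw bz <-.
apply: eq_map => d; rewrite !filter_cat /=.
(* If the filter drops [x] or [y], the two subwords coincide; if it keeps both, it also keeps the
   witness [b]. *)
have [dx|xd] := leqP d x; have [dy|yd] := leqP d y => //.
apply: (spine_swap _ sw); rewrite mem_filter bz andbT.
by case/orP: sw => /andP[? _]; [apply: leq_trans dx _|apply: leq_trans dy _].
Qed.

(** * Moving a block of smallest letters *)

Lemma sylv_block_swap a m p c z b : a <= b -> b < c -> b \in z ->
  sylv_equiv (p ++ nseq m a ++ c :: z) (p ++ c :: nseq m a ++ z).
Proof.
move=> ab bc bz; elim: m p => [|m IH] p; first exact: rst_refl.
apply: rst_trans (_ : sylv_equiv (p ++ a :: c :: nseq m a ++ z) _).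
  by have := IH (rcons p a); rewrite !cat_rcons.
by apply: (@sylv_swap _ _ _ _ b); rewrite ?mem_cat ?bz ?orbT // /swappable ab bc.
Qed.

(** The block forms at the last occurrence of [a]: every earlier copy moves right past larger
    letters, with a later copy of [a] as witness. *)
Lemma sylv_gather a w : all (leq a) w -> exists u z,
  u ++ z = [seq x <- w | a < x] /\
  sylv_equiv w (u ++ nseq (count_mem a w) a ++ z).
Proof.
elim: w => [|x w IH] /=; first by exists [::], [::]; split=> //; apply: rst_refl.
case/andP=> ax /IH[u [z [uz eqw]]]; have eqxw := sylv_equiv_cat2l [:: x] eqw.
move: ax; rewrite leq_eqVlt => /predU1P[eax|ax]; last first.
  by rewrite ax gtn_eqF // -uz; exists (x :: u), z.
subst x; rewrite ltnn eqxx; have [m0|mpos] := posnP (count_mem a w).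
  exists [::], [seq x <- w | a < x]; split=> //; rewrite m0 /=.
  by move: eqxw; rewrite m0 -uz.
exists u, z; split=> //; apply: rst_trans eqxw _ => /=.
have big : all (ltn a) u.
  by move: (filter_all (ltn a) w); rewrite -uz all_cat => /andP[].
elim: {uz eqw} u big => [|c u IHu] /=; first by move=> _; apply: rst_refl.
case/andP=> ac /IHu eqa; set s := u ++ _.
apply: rst_trans (sylv_equiv_cat2l [:: c] eqa).
apply: (@sylv_swap [::] _ _ _ a); first by rewrite /swappable leqnn ac.
by rewrite !mem_cat mem_nseq mpos eqxx orbT.
Qed.

(** Equal spines mean that no letter of [d] is a minimum, so each has a smaller letter to its right,
    which is the witness for moving the block past it. *)
Lemma sylv_slide a m u d z :
  all (ltn a) (d ++ z) -> spine (d ++ z) = spine z ->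
  sylv_equiv (u ++ nseq m a ++ d ++ z) (u ++ d ++ nseq m a ++ z).
Proof.
elim: d u => [|c d IH] u /=; first by move=> _ _; apply: rst_refl.
case/andP=> ac adz sp; have le := leq_spine_cat d z.
have /allPn[b bdz]: ~~ all (leq c) (d ++ z).
  by apply/negP => hc; rewrite hc in sp; lia.
rewrite -ltnNge => bc; have ab := allP adz b bdz.
apply: rst_trans (sylv_block_swap _ _ (ltnW ab) bc bdz) _.
by have := IH (rcons u c) adz; rewrite !cat_rcons; apply; lia.
Qed.

Lemma cat_eq_prefix (T : eqType) (u z u' z' : seq T) :
  u ++ z = u' ++ z' -> size u <= size u' ->
  exists2 d, u' = u ++ d & z = d ++ z'.
Proof.
elim: u u' => [|x u IH] [|x' u'] //=; first by exists [::].
- by exists (x' :: u').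
- by case=> -> e le; have [d -> ez] := IH _ e le; exists d.
Qed.

Lemma sylv_split_unique a m u z u' z' :
  all (ltn a) (u ++ z) -> u ++ z = u' ++ z' -> spine z = spine z' ->
  sylv_equiv (u ++ nseq m a ++ z) (u' ++ nseq m a ++ z').
Proof.
wlog le : u z u' z' / size u <= size u'.
  move=> H; have [le|/ltnW le] := leqP (size u) (size u'); first exact: H.
  by move=> al e sp; apply: rst_sym; apply: H; rewrite -?e.
move=> al e sp.
have [d eu' ez] := cat_eq_prefix e le; subst u' z; rewrite -catA.
by apply: sylv_slide => //; move: al; rewrite all_cat => /andP[].
Qed.

Lemma sylv_insert_block a m y y' : sylv_equiv y y' -> all (ltn a) y ->
  forall u z, y = u ++ z -> exists u' z',
    y' = u' ++ z' /\ sylv_equiv (u ++ nseq m a ++ z) (u' ++ nseq m a ++ z').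
Proof.
move: y y'; apply: sylv_ind => [y _ u z ->|p x1 x2 z0 b y' sw bz0 IH al u z e].
  by exists u, z; split=> //; apply: rst_refl.
have al' : all (ltn a) (p ++ x2 :: x1 :: z0).
  by move: al; rewrite !all_cat /= (andbCA (a < x1)).
have {}IH u1 z1 : p ++ x2 :: x1 :: z0 = u1 ++ z1 ->
    sylv_equiv (u ++ nseq m a ++ z) (u1 ++ nseq m a ++ z1) ->
  exists u' z',
    y' = u' ++ z' /\ sylv_equiv (u ++ nseq m a ++ z) (u' ++ nseq m a ++ z').
- by move=> e1 eq1; have [u' [z' [-> eq2]]] := IH al' _ _ e1; exists u', z';
    split=> //; apply: rst_trans eq1 eq2.
have ab : a <= b.
  by move: al; rewrite all_cat /= => /and4P[_ _ _ /allP/(_ _ bz0)/ltnW].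
have [le|lt] := leqP (size u) (size p).
- have [d ep ez] := cat_eq_prefix (esym e) le; subst p z.
  apply: (IH u (d ++ x2 :: x1 :: z0)); first by rewrite -catA.
  by have := @sylv_swap (u ++ nseq m a ++ d) _ _ _ _ sw bz0; rewrite -!catA.
have [d eu ez] := cat_eq_prefix e (ltnW lt); subst u.
have dne : 0 < size d by move: lt; rewrite size_cat -{1}[size p]addn0 ltn_add2l.
case: d dne {lt e} ez IH => // c [|c' d] _ /= [].
  (* The block separates the two swapped letters. It first moves past the larger one, with witness
     [b], which makes them adjacent again. *)
  move=> ec ez IH; subst c z; case/orP: (sw) => /andP[xb bx].
    apply: (IH (p ++ [:: x2; x1]) z0); first by rewrite -catA.
    rewrite -!catA /=.
    apply: rst_trans (_ : sylv_equiv (p ++ x1 :: x2 :: nseq m a ++ z0) _).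
      by have := sylv_block_swap m (rcons p x1) ab bx bz0; rewrite !cat_rcons.
    by apply: sylv_swap sw _; rewrite mem_cat bz0 orbT.
  apply: (IH p (x2 :: x1 :: z0)) => //.
  rewrite -!catA /=.
  apply: rst_trans (_ : sylv_equiv (p ++ nseq m a ++ x1 :: x2 :: z0) _).
    by apply: rst_sym; apply: (sylv_block_swap m p ab bx); rewrite inE bz0 orbT.
  by have := @sylv_swap (p ++ nseq m a) _ _ _ _ sw bz0; rewrite -!catA.
move=> ec ec' ez IH; subst c c' z0.
apply: (IH (p ++ x2 :: x1 :: d) z); first by rewrite -catA.
rewrite -!catA /=; apply: (sylv_swap p sw).
by move: bz0; rewrite !mem_cat => /orP[|] ->; rewrite ?orbT.
Qed.

(** * The code determines the class *)

Lemma spine_sylv w w' : sylv_equiv w w' -> spine w = spine w'.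
Proof.
move: w w'; apply: sylv_ind => // p x y z b w sw bz <-.
exact: spine_swap sw bz.
Qed.

(** Every copy of [a] is a minimum, and since the block is nonempty it hides every letter of [u]. *)
Lemma spine_block a m u z : 0 < m -> all (ltn a) (u ++ z) ->
  spine (u ++ nseq m a ++ z) = m + spine z.
Proof.
move=> m0; elim: u => [|x u IH] /=.
  move=> al; elim: m {m0} => //= m ->.
  by rewrite all_cat all_nseq leqnn orbT (sub_all _ al) // => x /ltnW.
case/andP=> ax /IH ->; case: m m0 {IH} => // m _.
by rewrite !all_cat /= leqNgt ax andbF.
Qed.

Lemma code_filter a ls w : all (ltn a) ls ->
  code ls [seq x <- w | a < x] = code ls w.
Proof.
move/allP=> al; apply/eq_in_map => b /al ab; rewrite -filter_predI.
congr spine; apply: eq_filter => x /=.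
by case: (leqP b x) => //= bx; rewrite (leq_trans ab bx).
Qed.

Lemma head_code ls w : sorted ltn ls -> {subset w <= ls} ->
  head 0 (code ls w) = spine w.
Proof.
case: ls => [|a ls] /= so sub; first by case: w sub => // x w /(_ x (mem_head _ _)).
rewrite (all_filterP _) //; apply/allP => x /sub; rewrite inE => /predU1P[-> //|].
by move=> xls; apply/ltnW; apply: (allP (order_path_min ltn_trans so)).
Qed.

Lemma sylv_gather_spine a w : a \in w -> all (leq a) w -> exists u z,
  [/\ u ++ z = [seq x <- w | a < x],
      sylv_equiv w (u ++ nseq (count_mem a w) a ++ z) &
      spine w = count_mem a w + spine z].
Proof.
move=> aw al; have [u [z [uz eqw]]] := sylv_gather al.
exists u, z; split=> //; rewrite (spine_sylv eqw) spine_block //.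
  by rewrite -has_count has_pred1.
by rewrite uz filter_all.
Qed.

Lemma code_inj ls w w' : sorted ltn ls -> {subset w <= ls} ->
  perm_eq w w' -> code ls w = code ls w' -> sylv_equiv w w'.
Proof.
elim: ls w w' => [|a ls IH] w w' so sub pw.
  case: w sub pw => [_|x w /(_ x (mem_head _ _)) //].
  by rewrite perm_sym => /perm_nilP -> _; apply: rst_refl.
have als : all (ltn a) ls := order_path_min ltn_trans so.
have alw : all (leq a) w.
  apply/allP => x /sub; rewrite inE => /predU1P[-> //|xls].
  by apply/ltnW/(allP als).
have alw' : all (leq a) w' by rewrite -(perm_all _ pw).
rewrite [code _ w]/= [code _ w']/= !(all_filterP _) // => -[spw].
rewrite -(code_filter w als) -(code_filter w' als) => /IH.
have subf : {subset [seq x <- w | a < x] <= ls}.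
  move=> x; rewrite mem_filter => /andP[ax /sub]; rewrite inE.
  by case/predU1P => // exa; rewrite exa ltnn in ax.
move=> /(_ (path_sorted so) subf (perm_filter _ pw)) eqf.
have [aw|naw] := boolP (a \in w); last first.
  have fE v : a \notin v -> all (leq a) v -> [seq x <- v | a < x] = v.
    move=> av /allP alv; apply/all_filterP/allP => x xv.
    by rewrite ltn_neqAle alv // andbT; apply: contraNneq av => ->.
  by move: eqf; rewrite !fE // -(perm_mem pw).
have aw' : a \in w' by rewrite -(perm_mem pw).
have [u [z [uz eqw sw]]] := sylv_gather_spine aw alw.
have [u' [z' [uz' eqw' sw']]] := sylv_gather_spine aw' alw'.
have count_w' : count_mem a w' = count_mem a w by rewrite (permP pw).
rewrite count_w' in eqw' sw'; set m := count_mem a w in eqw sw eqw' sw'.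
have m0 : 0 < m by rewrite -has_count has_pred1.
(* The block of [w] is carried along the equivalence of the two words without [a]; both blocks then
   sit in the same word, with equal spines to their right. *)
have [u1 [z1 [uz1 eq1]]] := sylv_insert_block m eqf (filter_all _ _) (esym uz).
have alf : all (ltn a) (u ++ z) by rewrite uz filter_all.
have sz : spine z = spine z1.
  have := spine_sylv eq1; rewrite !spine_block // -?uz1 ?filter_all //.
  by move/addnI.
apply: rst_trans eqw _; apply: rst_trans eq1 _; apply: rst_sym.
apply: rst_trans eqw' _.
have alf' : all (ltn a) (u' ++ z') by rewrite uz' filter_all.
apply: sylv_split_unique => //; first by rewrite uz'.
lia.
Qed.

(** * The codes that occur *)

Lemma base_word_cons a ls m al :
  base_word (a :: ls) (m :: al) = nseq m a ++ base_word ls al.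
Proof. by []. Qed.

Lemma base_word_sub ls al : {subset base_word ls al <= ls}.
Proof.
elim: ls al => [|a ls IH] [|m al] // x; rewrite base_word_cons mem_cat mem_nseq.
by rewrite inE => /orP[/andP[_ ->] //|/IH ->]; rewrite orbT.
Qed.

Lemma perm_base_word_cons a ls m al w : all (ltn a) ls ->
  perm_eq w (base_word (a :: ls) (m :: al)) ->
  [/\ all (leq a) w, count_mem a w = m &
      perm_eq [seq x <- w | a < x] (base_word ls al)].
Proof.
move=> /allP als; rewrite base_word_cons => pw.
have big : all (ltn a) (base_word ls al).
  by apply/allP => x /base_word_sub /als.
split.
- rewrite (perm_all _ pw) all_cat all_nseq leqnn orbT.
  by apply: sub_all big => x /ltnW.
- rewrite (permP pw) count_cat count_nseq /= eqxx mul1n.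
  rewrite (count_memPn _) ?addn0 //.
  by apply/negP => /(allP big); rewrite /= ltnn.
apply: perm_trans (perm_filter (ltn a) pw) _.
rewrite filter_cat (all_filterP big) filter_nseq /= ltnn.
exact: perm_refl.
Qed.

(* The first part of [alpha] belongs to the smallest letter, hence is added
   last; for the largest letter [head 0] supplies the spine 0 of the empty word. *)
Fixpoint codes (alpha : seq nat) : seq (seq nat) :=
  if alpha is m :: al then
    [seq m + t :: c | c <- codes al, t <- iota 0 (head 0 c).+1]
  else [:: [::]].

Lemma codes_cons m al :
  codes (m :: al) = [seq m + t :: c | c <- codes al, t <- iota 0 (head 0 c).+1].
Proof. by []. Qed.

Lemma codes_uniq alpha : uniq (codes alpha).
Proof.
elim: alpha => // m al IH; rewrite codes_cons; apply: allpairs_uniq_dep => //.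
  by move=> c _; apply: iota_uniq.
by move=> [c t] [c' t'] _ _ /= [/addnI -> ->].
Qed.

Lemma code_in_codes ls alpha w : sorted ltn ls -> size ls = size alpha ->
  all (ltn 0) alpha -> perm_eq w (base_word ls alpha) ->
  code ls w \in codes alpha.
Proof.
elim: ls alpha w => [|a ls IH] [|m al] w // so [sz] /andP[m0 pos] pw.
have als : all (ltn a) ls := order_path_min ltn_trans so.
have [alw cnt pf] := perm_base_word_cons als pw.
have aw : a \in w by rewrite -has_pred1 has_count cnt.
have [u [z [uz _ sw]]] := sylv_gather_spine aw alw.
rewrite codes_cons; apply/allpairsPdep; exists (code ls w), (spine z).
rewrite [code (_ :: _) w]/= -(code_filter w als) (all_filterP alw) sw cnt; split=> //.
  exact: IH (path_sorted so) sz pos pf.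
rewrite mem_iota add0n ltnS head_code ?(path_sorted so) //.
  by rewrite -uz leq_spine_cat.
by move=> x; rewrite (perm_mem pf); apply: base_word_sub.
Qed.

(** A discrete intermediate value argument: each letter put in front raises the spine by at most
    1. *)
Lemma spine_split w t : t <= spine w -> exists u z, w = u ++ z /\ spine z = t.
Proof.
elim: w t => [|x w IH] t /=.
  by rewrite leqn0 => /eqP ->; exists [::], [::].
rewrite leq_eqVlt => /predU1P[->|lt]; first by exists [::], (x :: w).
have [|u [z [-> <-]]] := IH t; last by exists (x :: u), z.
by case: (all _ _) lt; rewrite // add0n => /ltnW.
Qed.

Lemma code_surj ls alpha c : sorted ltn ls -> size ls = size alpha ->
  all (ltn 0) alpha -> c \in codes alpha ->
  exists2 w, perm_eq w (base_word ls alpha) & code ls w = c.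
Proof.
elim: ls alpha c => [|a ls IH] [|m al] c //.
  by rewrite inE => _ _ _ /eqP ->; exists [::].
move=> so [sz] /andP[m0 pos] /allpairsPdep[c' [t [cal]]].
have als : all (ltn a) ls := order_path_min ltn_trans so.
have so' := path_sorted so.
have [y py ey] := IH _ _ so' sz pos cal.
have suby : {subset y <= ls}.
  by move=> x; rewrite (perm_mem py); apply: base_word_sub.
rewrite mem_iota add0n ltnS -ey head_code // => /spine_split[u [z [yuz <-]]] ->.
have big : all (ltn a) y by apply/allP => x /suby /(allP als).
have pw : perm_eq (u ++ nseq m a ++ z) (base_word (a :: ls) (m :: al)).
  by rewrite base_word_cons perm_catCA perm_cat2l -yuz.
(* The block goes where exactly the required number of minima remains to its right. *)
exists (u ++ nseq m a ++ z) => //.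
have [alw _ _] := perm_base_word_cons als pw.
rewrite /= (all_filterP alw) spine_block -?yuz //; congr (_ :: _).
rewrite -[LHS](code_filter _ als) !filter_cat filter_nseq ltnn /= -filter_cat.
by rewrite -yuz (all_filterP big).
Qed.

(** [num_classes] requires a map defined on all of [T], so the index must make sense outside [P]
    too; [inord] provides it once [s] is nonempty. *)
Lemma num_classes_code (T : Type) (C : eqType) (R : T -> T -> Prop)
    (P : T -> Prop) (f : T -> C) (s : seq C) :
  0 < size s -> uniq s -> (forall x, P x -> f x \in s) ->
  (forall c, c \in s -> exists2 x, P x & f x = c) ->
  (forall x y, P x -> P y -> (R x y <-> f x = f y)) ->
  num_classes R P (size s).
Proof.
case: s => // c0 s _ us fs sf fR.
pose F x : 'I_(size (c0 :: s)) := inord (index (f x) (c0 :: s)).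
have FE x : P x -> F x = index (f x) (c0 :: s) :> nat.
  by move=> /fs; rewrite -index_mem => /inordK.
exists F; split=> [i|x y Px Py].
  have [x Px fx] := sf _ (mem_nth c0 (ltn_ord i)); exists x; split=> //.
  by apply: val_inj; rewrite /= FE // fx index_uniq.
rewrite fR //; split=> [e|/(congr1 val)]; first by rewrite /F e.
rewrite -[val]/(@nat_of_ord _) !FE // => e.
by rewrite -(nth_index c0 (fs _ Px)) e nth_index ?fs.
Qed.

(** * Counting codes from the largest letter down *)

(* The number of ways to extend a code with head [s] by parts [l], the part of
   the largest remaining letter coming first. *)
Fixpoint completions (l : seq nat) (s : nat) : nat :=
  if l is a :: l' then \sum_(0 <= t < s.+1) completions l' (a + t) else 1.

Lemma size_codes_catrev alpha l :
  size (codes (catrev l alpha)) =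
  \sum_(c <- codes alpha) completions l (head 0 c).
Proof.
elim: l alpha => [|a l IH] alpha; first by rewrite /= sum1_size.
rewrite [catrev _ _]/= IH codes_cons big_allpairs_dep /=.
by apply: eq_bigr => c _; rewrite /index_iota subn0.
Qed.

Lemma completions_gt0 l s : 0 < completions l s.
Proof. by elim: l s => //= a l IH s; rewrite big_nat_recl // addn_gt0 IH. Qed.

(** * Truncated binomials and the Steck determinant *)

(** The guard makes a negative lower index give 0, where truncated subtraction alone would give
    ['C(B, 0)], that is 1. *)
Definition dbin (B i x : nat) : nat := if i <= x then 'C(B, x - i) else 0.

Lemma dbinS B i x : dbin B.+1 i x.+1 = dbin B i x.+1 + dbin B i x.
Proof.
rewrite /dbin; case: (leqP i x) => ix; first by rewrite (leqW ix) subSn // binS.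
rewrite addn0; case: leqP => // ix'; have -> : i = x.+1 by lia.
by rewrite subnn !bin0.
Qed.

(** Pascal's rule on ['C(j.+1, l)] shifts the summation index, which the offset [e] absorbs in the
    induction on [j]. *)
Lemma dbin_vandermonde n B i j e : j < n ->
  \sum_(l < n) dbin B i (l + e) * 'C(j, l) = dbin (j + B) i (j + e).
Proof.
elim: j n e => [|j IH] [|n] e // jn.
  rewrite big_ord_recl bin0 muln1 big1 ?addn0 // => l _.
  by rewrite bin_small ?muln0.
rewrite addSn addSn dbinS -(IH n.+1 e (ltnW jn)) -addnS -(IH n e.+1 jn).
rewrite big_ord_recl [in RHS]big_ord_recl !bin0 addnCA; congr (_ + _).
rewrite -big_split; apply: eq_bigr => l _ /=.
by rewrite /bump /= add1n binS mulnDr addnS addSn addnC.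
Qed.

Section SteckDeterminant.
Local Open Scope ring_scope.

Definition steck (m : nat) (B : nat -> nat) : 'M[int]_m :=
  \matrix_(i < m, j < m) (dbin (B i) i j.+1)%:Z.

Lemma eq_steck m B B' : (forall i, (i < m)%N -> B i = B' i) ->
  steck m B = steck m B'.
Proof. by move=> eB; apply/matrixP => i j; rewrite !mxE eB. Qed.

Lemma det_steck0 m B : B 0%N = 0%N -> \det (steck m.+1 B) = 0.
Proof.
move=> B0; rewrite (expand_det_row _ ord0) big1 // => j _.
by rewrite mxE /dbin /= B0 bin0n mul0r.
Qed.

(* Pascal's rule is a column operation on every entry but the one at (0, 0),
   where the truncated binomial of lower index -1 is off by 1. *)
Lemma det_steck_rec m B :
  \det (steck m.+1 (fun i => (B i).+1)) =
  \det (steck m.+1 B) + \det (steck m (fun i => (B i.+1).+1)).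
Proof.
(* Right multiplication by [U] adds to each column the one before it. *)
pose U : 'M[int]_m.+1 := \matrix_(l, j) ('C(1, j - l)%:Z *+ (l <= j)%N).
have detU : \det U = 1.
  rewrite -det_tr det_trig; last first.
    by apply/is_trig_mxP => i j ij; rewrite !mxE leqNgt ij.
  by rewrite big1 // => i _; rewrite !mxE leqnn subnn.
set M := steck m.+1 _; set M0 := steck m.+1 B.
have mul0 i : (M0 *m U) i 0 = M0 i 0.
  rewrite mxE big_ord_recl big1 ?addr0 => [|l _].
    by rewrite [U _ _]mxE mulr1.
  by rewrite [U _ _]mxE mulr0.
have mulS i j : (M0 *m U) i (lift 0 j) = M i (lift 0 j).
  have jm : (j < m.+1)%N by rewrite ltnS ltnW.
  rewrite mxE (bigD1 (lift 0 j)) //= (bigD1 (Ordinal jm)) /=; last first.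
    by rewrite -val_eqE /= neq_ltn leqnn.
  rewrite !mxE /= /bump /= add1n leqnn subnn leqnSn subSnn bin0 bin1 !mulr1.
  rewrite big1 => [|l /andP[l1 l2]]; first by rewrite addr0 dbinS PoszD.
  rewrite !mxE /= /bump /= add1n; move: l1 l2; rewrite -!val_eqE /= /bump /=.
  rewrite add1n => l1 l2; case: leqP => lj; rewrite ?mulr0 //.
  by rewrite bin_small ?mulr0 //; lia.
(* The first column of [M] is that of [M0 *m U] plus the first unit vector. Linearity in this column
   leaves [\det E], which is the minor at (0, 0). *)
pose E : 'M[int]_m.+1 := \matrix_(i, j) if j == 0 then (i == 0)%:Z else M i j.
rewrite -[\det M0]mulr1 -detU -det_mulmx -[\det M]det_tr -[\det (_ *m _)]det_tr.
have -> : \det (steck m (fun i => (B i.+1).+1)) = \det E^T.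
  rewrite det_tr (expand_det_col _ 0) big_ord_recl big1 => [|i _]; last first.
    by rewrite mxE /= mul0r.
  rewrite mxE !eqxx mul1r addr0 /cofactor expr0 mul1r; congr (\det _).
  by apply/matrixP => i j; rewrite !mxE /= /bump /= !add1n /dbin ltnS subSS.
rewrite (@determinant_multilinear _ _ _ (M0 *m U)^T E^T 0 1 1) ?mul1r //.
- rewrite !scale1r; apply/rowP => i.
  rewrite [RHS]mxE ![row _ _ _ _]mxE ![_^T _ _]mxE mul0 !mxE /dbin eqxx.
  case: (unliftP 0 i) => [i' ->|->] /=; last by rewrite !subn0 !bin1; lia.
  rewrite /bump /= add1n ltnS leqn0 addr0; case: ifP => // /eqP ->.
  by rewrite subnn !bin0.
- by apply/matrixP => i j; rewrite ![row' _ _ _ _]mxE ![_^T _ _]mxE mulS.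
by apply/matrixP => i j; rewrite !mxE.
Qed.

(** Splitting off the term [t = s] of the sum matches [det_steck_rec]; at [s = 0] the first
    determinant there has a zero row. *)
Lemma completions_det l s :
  (completions l s)%:Z =
  \det (steck (size l) (fun i => (s + \sum_(j < i) nth 0 l j).+1)%N).
Proof.
elim: l s => [|a l IHl] s; first by rewrite det_mx00.
elim: s => [|s IHs] /=.
  rewrite big_nat1 addn0 IHl det_steck_rec det_steck0 ?big_ord0 // add0r.
  congr (\det _); apply: eq_steck => i _; by rewrite big_ord_recl /= add0n.
rewrite big_nat_recr //= PoszD; rewrite /= in IHs; rewrite IHs IHl [RHS]det_steck_rec.
congr (_ + \det _); apply: eq_steck => i _; by rewrite big_ord_recl addnCA addnA.
Qed.

Lemma det_steck_shift m (B : nat -> nat) :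
  \det (\matrix_(i < m, j < m) (dbin (j + B i) i j.+1)%:Z) = \det (steck m B).
Proof.
pose U : 'M[int]_m := \matrix_(l, j) 'C(j, l)%:Z.
have detU : \det U = 1.
  rewrite -det_tr det_trig; last first.
    by apply/is_trig_mxP => i j ij; rewrite !mxE bin_small.
  by rewrite big1 // => i _; rewrite !mxE binn.
rewrite -[RHS]mulr1 -detU -det_mulmx; congr (\det _).
apply/matrixP => i j; rewrite !mxE -[j.+1]addn1 -(dbin_vandermonde (n := m)) //.
rewrite -[LHS]natz natr_sum; apply: eq_bigr => l _.
by rewrite !mxE addn1 natz PoszM.
Qed.

End SteckDeterminant.

(** * The number of classes as a determinant *)

Unset Implicit Arguments.

Theorem theorem4p2 (n k : nat) (alpha letters : seq nat)
  (Hk : 0 < k) (Hsize : size alpha = k) (Hpos : all (fun a => 0 < a) alpha)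
  (Hn : sumn alpha = n)
  (Hlsize : size letters = k) (Hlpos : all (fun i => 0 < i) letters)
  (Hlsorted : sorted ltn letters) :
  exists N : nat,
    num_classes sylv_equiv (fun w => perm_eq w (base_word letters alpha)) N /\
    (N%:Z = \det (sylv_matrix k alpha))%R.
Proof.
have Hls : size letters = size alpha by rewrite Hlsize.
have sizeE : size (codes alpha) = completions (rev alpha) 0.
  have := size_codes_catrev [::] (rev alpha).
  by rewrite catrevE revK cats0 big_seq1.
exists (size (codes alpha)); split.
  apply: (@num_classes_code _ _ _ _ (code letters)).
  - by rewrite sizeE completions_gt0.
  - exact: codes_uniq.
  - by move=> w; apply: code_in_codes.
  - by move=> c; apply: code_surj.
  move=> w w' pw pw'; split; first exact: code_sylv.
  apply: code_inj => //; last by rewrite (perm_trans pw) // perm_sym.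
  by move=> x; rewrite (perm_mem pw); apply: base_word_sub.
(* From spine 0 only [t = 0] is possible, so the largest letter contributes no choice: the size
   drops to k - 1 and its multiplicity becomes the starting spine. *)
have {sizeE} -> : size (codes alpha) =
    completions (behead (rev alpha)) (head 0 (rev alpha)).
  rewrite sizeE; have := size_rev alpha; rewrite Hsize.
  by case: (rev alpha) Hk => [|a l] Hk /=; [lia|rewrite big_nat1 addn0].
rewrite completions_det size_behead size_rev Hsize -det_steck_shift.
congr (\det _)%R; apply/matrixP => i j; rewrite !mxE /dbin; case: leqP => // _.
(* The 1 in B_i = S_i + 1 turns the shift [j] into [j.+1]. *)
congr (Posz 'C(_, _)); rewrite addnS -addSn; congr (_ + _)%N.
rewrite big_ord_recl /= -nth0 nth_rev ?Hsize // subn1 subn0; congr (_ + _)%N.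
apply: eq_bigr => l _; rewrite nth_behead nth_rev ?Hsize /bump //=.
  by congr nth; lia.
by have := ltn_ord i; have := ltn_ord l; lia.
Qed.
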